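(* Let $X$ be a topological space and let $H$ be a functor from topological spaces to a category with a zero object. Then for any functions $f,g\colon X\to\mathbb{R}$ we have $$|\operatorname{lcs}_H(f)-\operatorname{lcs}_H(g)|\le 2\cdot\|f-g\|_\infty.$$
   Context: Functions $X\to\mathbb{R}$ need not be continuous, and $\|f-g\|_\infty=\sup_{x\in X}|f(x)-g(x)|$ is the supremum norm. For $f\colon X\to\mathbb{R}$ write $f_{\le t}=f^{-1}((-\infty,t])$ for $t\in\mathbb{R}$; these sets form the sublevel set filtration $f_{\le\bullet}$. For $\delta\ge0$, the filtration $f_{\le\bullet}$ is called $\delta$-HLC ($\delta$ homologically locally connected) with respect to $H$ if for any $x\in X$, any neighborhood $V$ of $x$, and any pair of indices $s,t$ with $f(x)<s\le s+\delta<t$ there is a neighborhood $U$ of $x$ with $U\subseteq V$ such that the inclusion $f_{\le s}\cap U\to f_{\le t}\cap V$ is taken to the trivial (zero) morphism by $H$. The local connectedness shift of $f$ with respect to $H$ is $\operatorname{lcs}_H(f)=\inf\{\delta>0\mid f_{\le\bullet}\text{ is }\delta\text{-HLC with respect to }H\}$. *)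

(* Defs.v *)
From HB Require Import structures.
From mathcomp Require Import all_boot all_order all_algebra.
From mathcomp Require Import all_classical all_reals all_analysis.

Set Implicit Arguments.
Unset Strict Implicit.
Unset Printing Implicit Defensive.

Import Order.TTheory GRing.Theory Num.Theory.
Import numFieldNormedType.Exports.

Local Open Scope classical_set_scope.
Local Open Scope ring_scope.

Record category := Category {
  obj : Type;
  mor : obj -> obj -> Type;
  id_mor : forall a, mor a a;
  comp_mor : forall a b c, mor b c -> mor a b -> mor a c;
  comp_mor1 : forall a b (u : mor a b), comp_mor u (id_mor a) = u;
  comp_1mor : forall a b (u : mor a b), comp_mor (id_mor b) u = u;
  comp_morA : forall a b c d (w : mor c d) (v : mor b c) (u : mor a b),
    comp_mor w (comp_mor v u) = comp_mor (comp_mor w v) u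
}.

Record functor (C D : category) := Functor {
  functor_obj : obj C -> obj D;
  functor_mor : forall a b, mor a b -> mor (functor_obj a) (functor_obj b);
  functor_id : forall a, functor_mor (id_mor a) = id_mor (functor_obj a);
  functor_comp : forall a b c (v : mor b c) (u : mor a b),
    functor_mor (comp_mor v u) = comp_mor (functor_mor v) (functor_mor u)
}.

Record zero_object (C : category) := ZeroObject {
  zero_obj : obj C;
  to_zero : forall a, mor a zero_obj;
  from_zero : forall a, mor zero_obj a;
  to_zero_unique : forall a (u : mor a zero_obj), u = to_zero a;
  from_zero_unique : forall a (u : mor zero_obj a), u = from_zero a
}.

Definition zero_mor (C : category) (Z : zero_object C) (a b : obj C) :
  mor a b := comp_mor (from_zero Z b) (to_zero Z a).

Section top_category.

Let top_id (X : topologicalType) : continuousType X X := idfun.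

Let top_comp (X Y Z : topologicalType) (v : continuousType Y Z)
  (u : continuousType X Y) : continuousType X Z := v \o u.

Let top_comp1 (X Y : topologicalType) (u : continuousType X Y) :
  top_comp u (top_id X) = u.
Proof. exact/continuousEP. Qed.

Let top_1comp (X Y : topologicalType) (u : continuousType X Y) :
  top_comp (top_id Y) u = u.
Proof. exact/continuousEP. Qed.

Let top_compA (W X Y Z : topologicalType) (w : continuousType Y Z)
    (v : continuousType X Y) (u : continuousType W X) :
  top_comp w (top_comp v u) = top_comp (top_comp w v) u.
Proof. exact/continuousEP. Qed.

Definition Top : category := Category top_comp1 top_1comp top_compA.

End top_category.

(* [set_type A] carries the subspace topology; the library's [subspace A] would
   be wrong here, since it retopologizes the whole ambient type. *)
Definition incl_fun (X : topologicalType) (A B : set X) (AB : A `<=` B)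
  (x : set_type A) : set_type B := SigSub (mem_set (AB _ (set_mem (valP x)))).

Lemma incl_fun_continuous (X : topologicalType) (A B : set X)
  (AB : A `<=` B) : continuous (incl_fun AB).
Proof.
apply: continuous_comp_initial.
have -> : set_val \o incl_fun AB = set_val by apply/funext => x; rewrite !set_valE.
exact: initial_continuous.
Qed.

Definition incl_top (X : topologicalType) (A B : set X) (AB : A `<=` B) :
    @mor Top (set_type A) (set_type B) :=
  mkcts (@incl_fun_continuous X A B AB).

Section lcs.
Context {R : realType} {X : topologicalType}.
Context {C : category} (Z : zero_object C) (H : functor Top C).
Implicit Types f : X -> R.

Definition sublevel f (t : R) : set X := f @^-1` `]-oo, t].

Lemma sublevel_mono f (s t : R) : s <= t -> sublevel f s `<=` sublevel f t.
Proof. by move=> st x; rewrite /sublevel /= !in_itv /=; move/le_trans; apply. Qed.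

Lemma sublevelI_mono f (s t d : R) (U V : set X) :
  s <= s + d -> s + d < t -> U `<=` V ->
  sublevel f s `&` U `<=` sublevel f t `&` V.
Proof.
move=> sd dt UV; apply: setISS => //.
exact: sublevel_mono (le_trans sd (ltW dt)).
Qed.

Definition HLC (d : R) f :=
  forall (x : X) (V : set X), nbhs x V ->
  forall (s t : R), f x < s -> forall (sd : s <= s + d) (dt : s + d < t),
  exists (U : set X) (UV : U `<=` V), nbhs x U /\
    functor_mor H (incl_top (@sublevelI_mono f s t d U V sd dt UV)) = zero_mor Z _ _.

(* Takes values in [0, +oo]; it is +oo when no d works. *)
Definition lcs f : \bar R :=
  ereal_inf [set d%:E | d in [set d : R | 0 < d /\ HLC d f]].

(* The maximum with 0 only matters when X is empty, where the supremum is
   taken in [0, +oo] and is hence 0, while [ereal_sup set0 = -oo]. *)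
Definition sup_norm f : \bar R :=
  maxe 0%E (ereal_sup [set `|f x|%:E | x in [set: X]]).

End lcs.

(* Distance on extended reals, with the convention |oo - oo| = 0; the plain
   [`|x - y|%E] would give +oo when x = y = +oo. *)
Definition ereal_dist (R : realType) (x y : \bar R) : \bar R :=
  if x == y then 0%E else `|x - y|%E.

(* Main.v *)
(* Put e = ||f - g||. If f is d-HLC then g is (d + 2e)-HLC: apply the condition
   for f at the levels s + e and t - e, and factor the inclusion
   g_{<= s} /\ U -> g_{<= t} /\ V through the resulting null inclusion
   f_{<= s + e} /\ U -> f_{<= t - e} /\ V. *)
Require Import Defs.
From mathcomp Require Import all_boot all_order all_algebra.
From mathcomp Require Import all_classical all_reals all_analysis.
From mathcomp Require Import lra.
Import Order.TTheory GRing.Theory Num.Theory.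

Local Open Scope ring_scope.
Local Open Scope ereal_scope.

Lemma comp_zero_mor (C : category) (Z : zero_object C) (a b c d : obj C)
    (v : mor c d) (u : mor a b) :
  comp_mor v (comp_mor (zero_mor Z b c) u) = zero_mor Z a d.
Proof.
rewrite /zero_mor -comp_morA comp_morA.
by rewrite (to_zero_unique (comp_mor _ u)) (from_zero_unique (comp_mor v _)).
Qed.

(** [AD] is arbitrary, not the composite of [AB] and [BD]: the underlying points decide equality, so
    the inclusion proofs carried by [incl_top] never obstruct a rewrite. *)
Lemma incl_top_comp (X : topologicalType) (A B D : set X)
    (AB : (A `<=` B)%classic) (BD : (B `<=` D)%classic)
    (AD : (A `<=` D)%classic) :
  comp_mor (incl_top BD) (incl_top AB) = incl_top AD.
Proof. by apply/continuousEP => x; apply/val_inj. Qed.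

Section Stability.
Context {R : realType} {X : topologicalType} {C : category}.
Context (Z : zero_object C) (H : functor Top C).
Implicit Types f g : X -> R.

(** The inclusion of [A] in [E] factors as A -> B -> D -> E, and a composite with a zero morphism in
    the middle is zero. *)
Lemma incl_null_mono {A B D E : set X} {AE : (A `<=` E)%classic}
    {BD : (B `<=` D)%classic} :
  (A `<=` B)%classic -> (D `<=` E)%classic ->
  functor_mor H (incl_top BD) = zero_mor Z _ _ ->
  functor_mor H (incl_top AE) = zero_mor Z _ _.
Proof.
move=> AB DE BD0; have AD := subset_trans AB BD.
rewrite -(incl_top_comp _ _ _ _ AD DE) -(incl_top_comp _ _ _ _ AB BD AD).
by rewrite !functor_comp BD0 comp_zero_mor.
Qed.

Lemma sublevel_shift f g (e s t : R) : (forall x, `|f x - g x| <= e)%R ->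
  (s + e <= t)%R -> (sublevel f s `<=` sublevel g t)%classic.
Proof.
move=> fge st x; rewrite /sublevel /= !in_itv /= => fxs.
by have := fge x; rewrite ler_norml => /andP[? ?]; lra.
Qed.

Lemma HLC_shift f g (d e : R) : (0 < d)%R -> (0 <= e)%R ->
  (forall x, `|f x - g x| <= e)%R -> HLC Z H d f -> HLC Z H (d + 2 * e) g.
Proof.
move=> d0 e0 fge fHLC x V xV s t gxs sd dt.
have gfe y : (`|g y - f y| <= e)%R by rewrite distrC.
have fxs : (f x < s + e)%R.
  by have := fge x; rewrite ler_norml => /andP[? ?]; lra.
have sd' : (s + e <= s + e + d)%R by lra.
(* Raising [s] and lowering [t] by [e] each uses up exactly the extra [2 * e] in the shift. *)
have dt' : (s + e + d < t - e)%R by lra.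
have [U [UV [xU U0]]] := fHLC x V xV _ _ fxs sd' dt'.
exists U, UV; split=> //; apply: incl_null_mono U0.
- by apply: setSI; exact: (sublevel_shift _ _ e).
- by apply: setSI; apply: (sublevel_shift _ _ e) => //; lra.
Qed.

Lemma lcs_ge0 f : 0 <= lcs Z H f.
Proof. by apply: le_ereal_inf_tmp => _ [d [d0 _] <-]; rewrite lee_fin ltW. Qed.

Lemma lcs_shift f g (e : R) : (0 <= e)%R ->
  (forall x, `|f x - g x| <= e)%R -> lcs Z H g <= lcs Z H f + (2 * e)%:E.
Proof.
(* With the finite [2 * e] on the left, it suffices to bound each admissible [d] from below; if
   there is none, [lcs Z H f] is +oo and the bound is vacuous. *)
move=> e0 fge; rewrite -leeBlDr //; apply: le_ereal_inf_tmp => _ [d [d0 fd] <-].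
rewrite leeBlDr // -EFinD; apply: ereal_inf_lbound.
exists (d + 2 * e)%R => //; split; first by lra.
exact: HLC_shift fd.
Qed.

End Stability.

Lemma le_sup_norm (R : realType) (X : topologicalType) (f : X -> R) (x : X) :
  `|f x|%:E <= sup_norm f.
Proof. by rewrite le_max ereal_sup_ubound ?orbT//; exists x. Qed.

(** Nonnegativity excludes -oo, and since [e] is finite the two bounds make [x] and [y] infinite
    together; that case has distance 0 by convention. *)
Lemma ereal_dist_le (R : realType) (x y : \bar R) (e : R) :
  0 <= x -> 0 <= y -> (0 <= e)%R -> x <= y + e%:E -> y <= x + e%:E ->
  ereal_dist x y <= e%:E.
Proof.
rewrite /ereal_dist; case: eqP => [_ _ _ e0 _ _|]; first by rewrite lee_fin.
case: x y => [x| |] [y| |] //= _ _ _ _; rewrite !lee_fin => xy yx.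
by rewrite ler_norml; apply/andP; split; lra.
Qed.

Theorem proposition7p1 (R : realType) (X : topologicalType) (C : category)
    (Z : zero_object C) (H : functor Top C) (f g : X -> R) :
  ereal_dist (lcs Z H f) (lcs Z H g) <= 2%:E * sup_norm (f \- g)%R.
Proof.
have : 0 <= sup_norm (f \- g)%R by rewrite le_max lexx.
have := le_sup_norm R X (f \- g)%R.
(* An infinite norm makes the right-hand side +oo; the value -oo contradicts nonnegativity. *)
case: (sup_norm _) => [e fge e0| _ _|//]; last first.
  by rewrite gt0_muley ?leey // lte_fin.
rewrite lee_fin in e0; have {}fge x : (`|f x - g x| <= e)%R.
  by rewrite -lee_fin; exact: fge.
rewrite -EFinM; apply: ereal_dist_le; rewrite ?lcs_ge0 ?mulr_ge0 //.
- by apply: lcs_shift => // x; rewrite distrC.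
- exact: lcs_shift.
Qed.
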